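(* If $X$ is a locally connected compact metric space, then there is no expansive homeomorphism $T\colon X\to X$ such that $(X,T)$ is a CAM $\mathbb{Z}$-system.
   Context: A $\mathbb{Z}$-system $(X,T)$ is a compact metric space $X$ with a homeomorphism $T$. It is expansive if there is $c>0$ such that for all $x\neq y$ there exists $n\in\mathbb{Z}$ with $d(T^nx,T^ny)>c$. It is topologically transitive if for all nonempty open $U,V$ there is $n$ with $T^nU\cap V\neq\emptyset$; the action is faithful if $T^n=\mathrm{id}$ only for $n=0$. A point is periodic if its orbit is finite. The system is chaotic almost minimal (CAM) if: (1) it is topologically transitive and the action is faithful; (2) the periodic points are dense in $X$; (3) every proper closed $T$-invariant subset of $X$ is finite. *)

(* Defs.v *)
From HB Require Import structures.
From mathcomp Require Import all_boot all_order all_algebra.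
From mathcomp Require Import all_classical all_reals all_analysis.
Set Implicit Arguments. Unset Strict Implicit. Unset Printing Implicit Defensive.
Import Order.TTheory GRing.Theory Num.Theory.
Local Open Scope classical_set_scope.
Local Open Scope ring_scope.

Definition iterz {X : Type} (T Tinv : X -> X) (n : int) : X -> X :=
  match n with
  | Posz k => iter k T
  | Negz k => iter k.+1 Tinv
  end.

Definition homeomorphism {X : topologicalType} (T Tinv : X -> X) : Prop :=
  cancel T Tinv /\ cancel Tinv T /\ continuous T /\ continuous Tinv.

Definition locally_connected (X : topologicalType) : Prop :=
  forall (x : X) (U : set X), nbhs x U ->
    exists V : set X, [/\ open V, V x, connected V & V `<=` U].

Definition expansive {R : realType} {X : metricType R} (T Tinv : X -> X) : Prop :=
  exists c : R, 0 < c /\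
    forall x y : X, x <> y ->
      exists n : int, c < mdist (iterz T Tinv n x) (iterz T Tinv n y).

Definition topologically_transitive {X : topologicalType} (T Tinv : X -> X) : Prop :=
  forall U V : set X, open U -> open V -> U !=set0 -> V !=set0 ->
    exists n : int, (iterz T Tinv n @` U) `&` V !=set0.

Definition faithful_action {X : Type} (T Tinv : X -> X) : Prop :=
  forall n : int, iterz T Tinv n = id -> n = 0.

Definition periodic_point {X : Type} (T Tinv : X -> X) (x : X) : Prop :=
  finite_set [set iterz T Tinv n x | n in [set: int]].

Definition T_invariant {X : Type} (T : X -> X) (A : set X) : Prop :=
  T @` A = A.

Definition CAM {X : topologicalType} (T Tinv : X -> X) : Prop :=
  [/\ topologically_transitive T Tinv /\ faithful_action T Tinv,
      dense (periodic_point T Tinv)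
    & forall A : set X, closed A -> A <> [set: X] -> T_invariant T A ->
        finite_set A].

(* Main.v *)
Require Import Defs.
From HB Require Import structures.
From mathcomp Require Import all_boot all_order all_algebra.
From mathcomp Require Import all_classical all_reals all_analysis.
From mathcomp Require Import lra.
Import Order.TTheory GRing.Theory Num.Theory.
Import numFieldNormedType.Exports.
Local Open Scope classical_set_scope.
Local Open Scope ring_scope.

Set Implicit Arguments.
Unset Strict Implicit.

(** Mane's argument, with fine chains in place of continua.  The CAM hypotheses
    provide a non-isolated periodic point [q] with orbit [s], and a periodic
    point [z0] outside [s].  By expansiveness some iterate, say a forward one,
    blows a small connected neighbourhood of [q] up to size [eps]; at the first
    such time its whole long past is [eps]-small and shadows [s].  Whenever a
    chain-connected set grows past [eps], it contains a smaller one of size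
    between [delta] and [eps] that stays away from the orbits of [q] and [z0].
    By uniform expansiveness it grows back within [N] steps, where [N] depends
    only on [delta].  So some point keeps its forward orbit out of a fixed
    neighbourhood [U] of [z0], chosen after [N]; this works because [z0] is
    periodic.  In the limit this gives [x] with full orbit avoiding [U], hence
    lying in a finite invariant set, and [y] in [s] distinct from [x], such that
    the pasts of [x] and [y] stay [eps]-close.  Both being periodic, they stay
    [eps]-close for all time, which contradicts expansiveness. *)

(** * Compactness and continuity of the metric *)

Lemma compact_decreasing_closed {Y : topologicalType} (P : nat -> set Y) :
  compact [set: Y] -> (forall n, closed (P n)) ->
  (forall m n, (m <= n)%N -> P n `<=` P m) -> (forall n, P n !=set0) ->
  exists y, forall n, P n y.
Proof.
move=> cY clP decP P0.
have FF : ProperFilter (filter_from [set: nat] P).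
  apply: filter_from_proper; last by move=> n _; exact: P0.
  apply: filter_from_filter; first by exists 0%N.
  move=> i j _ _; exists (maxn i j) => // y Py.
  by split; apply: decP Py; rewrite ?leq_maxl ?leq_maxr.
have [y [_ cly]] := cY _ FF (filterT).
exists y => n; apply: clP => B By.
have [|z [Pz Bz]] := cly (P n) B _ By; first by exists n.
by exists z.
Qed.

Section Metric.
Context {R : realType} {X : metricType R}.
Implicit Types (x y u v : X) (D : set X) (E : X -> X -> Prop).

Lemma mdist_continuous : continuous (fun p : X * X => mdist p.1 p.2).
Proof.
case=> x y; apply/cvg_ballP => e e0; rewrite /=.
exists (ball x (e / 2), ball y (e / 2)).
  by split; apply: nbhsx_ballx; rewrite divr_gt0.
case=> u v []; rewrite !ballEmdist /ball /= => xu yv.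
have := metric_triangle x u v; have := metric_triangle x y v.
have := metric_triangle u v y; have := metric_triangle u x y.
have := metric_triangle x v y; have := metric_triangle u x v.
rewrite (metric_sym u x) (metric_sym v y) => *.
by rewrite ltr_norml; lra.
Qed.

Lemma near_mdist x (e : R) : 0 < e -> \forall y \near x, mdist x y < e.
Proof. by move=> /(near_ball x); rewrite ballEmdist. Qed.

(** * Fine chains: boundary bumping and selection of pieces *)

(* [D] has no proper nonempty [E]-closed part, i.e. for a symmetric [E] any two
   points of [D] are joined by a chain of [E]-steps inside [D]. *)
Definition linked E D : Prop :=
  forall A : set X, (exists2 x, D x & A x) ->
  (forall u v, D u -> D v -> E u v -> A u -> A v) -> D `<=` A.

(** If [A] is closed under steps, the trace of [A] on [D] is both open and closed in [D]: the
    interiors of the [E b] cover it for [b] inside and, by symmetry, miss it for [b] outside. *)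
Lemma connected_linked E D :
  (forall u v, E u v -> E v u) -> (forall u, nbhs u (E u)) ->
  connected D -> linked E D.
Proof.
move=> symE nE cD A [x Dx Ax] clA.
suff <- : D `&` A = D by apply: subIsetr.
apply: cD; first by exists x.
  exists (\bigcup_(b in D `&` A) (E b)°).
    by apply: bigcup_open => b _; exact: open_interior.
  apply/seteqP; split=> y [Dy].
    by move=> Ay; split => //; exists y => //; exact: nE.
  by move=> [b [Db Ab] /interior_subset Eby]; split => //; apply: clA Eby Ab.
exists (~` \bigcup_(b in D `\` A) (E b)°).
  by rewrite closedC; apply: bigcup_open => b _; exact: open_interior.
apply/seteqP; split=> y [Dy].
  move=> Ay; split => // -[b [Db nAb] /interior_subset/symE Eyb].
  by apply: nAb; exact: clA Eyb Ay.
move=> nB; split => //; apply: contrapT => nAy; apply: nB.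
by exists y => //; exact: nE.
Qed.

Lemma linked_image E E' D (h : X -> X) :
  (forall u v, E u v -> E' (h u) (h v)) -> linked E D -> linked E' (h @` D).
Proof.
move=> EE' lD A [_ [x Dx <-] Ax] clA _ [y Dy <-].
apply: (lD (h @^-1` A)) Dy; first by exists x.
by move=> u v Du Dv /EE'; apply: clA; [exists u|exists v].
Qed.

(** Boundary bumping for chains: the chain component of [x] in the part of [D] within [rho] of [x]
    comes within one step of the edge, since otherwise no chain in [D] could leave it to reach
    [y]. *)
Lemma linked_bump E D (rho eta : R) x y :
  (forall u v, E u v -> E v u) -> (forall u v, E u v -> mdist u v <= eta) ->
  0 < rho -> linked E D -> D x -> D y -> rho <= mdist x y ->
  exists D', [/\ D' `<=` D, linked E D', D' x,
    forall z, D' z -> mdist x z < rho &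
    exists2 z, D' z & rho - eta <= mdist x z].
Proof.
move=> symE Eeta rho0 lD Dx Dy xy.
pose B z := D z /\ mdist x z < rho.
(* The points reachable from [x] by steps inside [B], encoded as the intersection of all step-closed
   sets containing [x]. *)
pose D' z := forall A : set X, A x ->
  (forall u v, B u -> B v -> E u v -> A u -> A v) -> A z.
have Bx : B x by split; rewrite ?mdistxx.
have D'B z : D' z -> B z by move=> D'z; apply: D'z.
have D'x : D' x by move=> A.
have D'E u v : D' u -> B v -> E u v -> D' v.
  move=> D'u Bv Euv A Ax clA; have Bu := D'B _ D'u.
  by apply: (clA u v) => //; exact: D'u.
exists D'; split => //.
- by move=> z /D'B[].
- move=> A [z D'z Az] clA.
  have Ax : A x.
    (* By symmetry of [E], the points of [D'] outside [A] are closed under steps too; if [x] were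
       one of them, so would be [z]. *)
    apply: contrapT => nAx; suff [_] : D' z /\ ~ A z by [].
    apply: (D'z (fun u => D' u /\ ~ A u)) => // u v Bu Bv Euv [D'u nAu].
    have D'v : D' v by exact: D'E Euv.
    by split => // Av; apply: nAu; exact: clA (symE _ _ Euv) Av.
  move=> w D'w; suff [] : D' w /\ A w by [].
  apply: (D'w (fun u => D' u /\ A u)) => // u v Bu Bv Euv [D'u Au].
  have D'v : D' v by exact: D'E Euv.
  by split => //; exact: clA Euv Au.
- by move=> z /D'B[].
- apply: contrapT => far.
  have near_x z : D' z -> mdist x z < rho - eta.
    by move=> D'z; rewrite ltNge; apply/negP => le; apply: far; exists z.
  have : D' y.
    apply: (lD D') Dy; first by exists x.
    move=> u v Du Dv Euv D'u; apply: D'E (Euv) => //; split => //.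
    have := Eeta _ _ Euv; have := near_x _ D'u.
    by have := metric_triangle x u v; lra.
  by move=> /D'B[_]; rewrite ltNge xy.
Qed.

(** Induction on [s]: bumping to radius [rho / 4] around an endpoint at distance at least [rho / 2]
    from [g] keeps away from [g], and steps of at most [rho / 8] leave size at least [rho / 8] for
    the rest of [s]. *)
Lemma linked_avoid (s : seq X) (rho : R) : 0 < rho ->
  exists delta r eta : R, [/\ 0 < delta, 0 < r, 0 < eta &
  forall E D a b, (forall u v, E u v -> E v u) ->
    (forall u v, E u v -> mdist u v <= eta) -> linked E D ->
    D a -> D b -> rho <= mdist a b ->
  exists D', [/\ D' `<=` D, linked E D',
    exists a' b', [/\ D' a', D' b' & delta <= mdist a' b'] &
    forall y z, y \in s -> D' z -> r <= mdist y z]].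
Proof.
elim: s rho => [|g s IHs] rho rho0.
  exists rho, 1, 1; split => // E D a b _ _ lD Da Db ab.
  by exists D; split => //; exists a, b.
have rho8 : 0 < rho / 8 by rewrite divr_gt0.
have [delta [r [eta [d0 r0 e0 H]]]] := IHs _ rho8.
exists delta, (Num.min r (rho / 4)), (Num.min eta (rho / 8)).
split=> [|||{IHs}]; rewrite ?lt_min ?r0 ?e0 ?divr_gt0 //.
move=> E D a b symE Eeta lD Da Db ab.
have Eeta1 u v : E u v -> mdist u v <= eta.
  by move=> /Eeta; rewrite le_min => /andP[].
have Eeta2 u v : E u v -> mdist u v <= rho / 8.
  by move=> /Eeta; rewrite le_min => /andP[].
(* One of the endpoints is far from [g]: bump around that one. *)
wlog ga : a b Da Db ab / rho / 2 <= mdist g a.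
  move=> W; have [|ga] := lerP (rho / 2) (mdist g a); first exact: (W a b).
  apply: (W b a) => //; first by rewrite metric_sym.
  by have := metric_triangle a g b; rewrite (metric_sym a g); lra.
have rho4 : 0 < rho / 4 by lra.
have ab4 : rho / 4 <= mdist a b by lra.
have [D1 [D1D lD1 D1a D1lt [z D1z az]]] :=
  linked_bump symE Eeta2 rho4 lD Da Db ab4.
have az8 : rho / 8 <= mdist a z by lra.
have [D' [D'D1 lD' ab' av]] := H E D1 a z symE Eeta1 lD1 D1a D1z az8.
exists D'; split => //; first exact: subset_trans D1D.
move=> y w; rewrite inE ge_min => /orP[/eqP -> D'w|ys D'w]; apply/orP.
  right; have := D1lt _ (D'D1 _ D'w); have := metric_triangle g w a.
  by rewrite (metric_sym w a); lra.
by left; exact: av.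
Qed.

(** The constants precede [E] and [D], so that one choice serves the relations [shadows f eta n] for
    all [n]. *)
Definition selects (s : seq X) (eps delta r eta : R) : Prop :=
  forall E D a b, (forall u v, E u v -> E v u) ->
    (forall u v, E u v -> mdist u v <= eta) -> linked E D ->
    D a -> D b -> eps <= mdist a b ->
  exists D', [/\ D' `<=` D, linked E D',
    exists a' b', [/\ D' a', D' b' & delta <= mdist a' b'],
    forall y z, y \in s -> D' z -> r <= mdist y z &
    forall u v, D' u -> D' v -> mdist u v <= eps].

(** A bump of radius [eps / 2] bounds the diameter by [eps]; with steps of at most [eps / 4] it
    keeps size at least [eps / 4], to which [linked_avoid] applies. *)
Lemma linked_select (s : seq X) (eps : R) : 0 < eps ->
  exists delta r eta : R, [/\ 0 < delta, 0 < r, 0 < eta &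
    selects s eps delta r eta].
Proof.
move=> eps0; have eps4 : 0 < eps / 4 by lra.
have [delta [r [eta [d0 r0 e0 H]]]] := linked_avoid s eps4.
exists delta, r, (Num.min eta (eps / 4)).
split=> [||| E D a b symE Eeta lD Da Db ab] //.
  by rewrite lt_min e0.
have Eeta1 u v : E u v -> mdist u v <= eta.
  by move=> /Eeta; rewrite le_min => /andP[].
have Eeta2 u v : E u v -> mdist u v <= eps / 4.
  by move=> /Eeta; rewrite le_min => /andP[].
have eps2 : 0 < eps / 2 by lra.
have ab2 : eps / 2 <= mdist a b by lra.
have [D1 [D1D lD1 D1a D1lt [z D1z az]]] :=
  linked_bump symE Eeta2 eps2 lD Da Db ab2.
have az4 : eps / 4 <= mdist a z by lra.
have [D' [D'D1 lD' ab' av]] := H E D1 a z symE Eeta1 lD1 D1a D1z az4.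
exists D'; split => //; first exact: subset_trans D1D.
move=> u v /D'D1/D1lt au /D'D1/D1lt av'.
by have := metric_triangle u a v; rewrite (metric_sym u a); lra.
Qed.

(** * Iterates and uniform expansiveness *)

Lemma iter_continuous (f : X -> X) n : continuous f -> continuous (iter n f).
Proof.
move=> cf; elim: n => [|n IHn] x /=; first exact: cvg_id.
by apply: (@continuous_comp _ _ _ (iter n f) f); [exact: IHn|exact: cf].
Qed.

Lemma near_iter_mdist (f : X -> X) n x (e : R) : continuous f -> 0 < e ->
  \forall y \near x, forall j, (j <= n)%N ->
    mdist (iter j f x) (iter j f y) < e.
Proof.
move=> cf e0.
have : \forall y \near x, forall j : 'I_n.+1,
    mdist (iter j f x) (iter j f y) < e.
  apply: filter_forall => j.
  exact: (@iter_continuous f j cf x _ (near_mdist (iter j f x) e0)).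
apply: filterS => y H j jn; exact: (H (Ordinal (jn : (j < n.+1)%N))).
Qed.

Lemma closed_mdist_le (h : X -> X) (e : R) : continuous h ->
  closed [set p : X * X | mdist (h p.1) (h p.2) <= e].
Proof.
move=> ch.
apply: (@preimage_closed _ _ (fun p : X * X => mdist (h p.1) (h p.2))
  [set t | t <= e]); last exact: closed_le.
move=> p _; apply: (@continuous_comp _ _ _ (fun p : X * X => (h p.1, h p.2))
  (fun p : X * X => mdist p.1 p.2)); last exact: mdist_continuous.
apply: cvg_pair => /=.
  by apply: (@continuous_comp _ _ _ fst h); [exact: cvg_fst|exact: ch].
by apply: (@continuous_comp _ _ _ snd h); [exact: cvg_snd|exact: ch].
Qed.

Lemma closed_mdist_ge (e : R) : closed [set p : X * X | e <= mdist p.1 p.2].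
Proof.
apply: (@preimage_closed _ _ (fun p : X * X => mdist p.1 p.2)
  [set t | e <= t]); last exact: closed_ge.
by move=> p _; exact: mdist_continuous.
Qed.

(** The two time directions are kept apart, so that exchanging [f] and [g] only exchanges the
    alternatives. *)
Definition expands (f g : X -> X) (c : R) : Prop :=
  forall x y, x <> y -> exists n,
    c < mdist (iter n f x) (iter n f y) \/ c < mdist (iter n g x) (iter n g y).

(** Otherwise the pairs at distance at least [delta] that stay [c]-close for [N] steps both ways
    form nested nonempty closed sets, and a common pair contradicts [expands]. *)
Lemma uniform_expands (f g : X -> X) (c delta : R) :
  compact [set: X] -> continuous f -> continuous g -> 0 < delta ->
  expands f g c -> exists N, forall x y, delta <= mdist x y ->
    exists2 n, (n <= N)%N & c < mdist (iter n f x) (iter n f y) \/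
                            c < mdist (iter n g x) (iter n g y).
Proof.
move=> cX cf cg d0 fgc; apply: contrapT => noN.
pose P N := [set p : X * X | delta <= mdist p.1 p.2] `&`
  \bigcap_(n in [set n | (n <= N)%N])
    ([set p : X * X | mdist (iter n f p.1) (iter n f p.2) <= c] `&`
     [set p : X * X | mdist (iter n g p.1) (iter n g p.2) <= c]).
have [|N|m n mn p [dp Pp]|N|[x y] Pxy] := @compact_decreasing_closed _ P.
- by rewrite -setXTT; exact: compact_setX.
- apply: closedI; first exact: closed_mdist_ge.
  apply: closed_bigI => n _.
  by apply: closedI; apply: closed_mdist_le; exact: iter_continuous.
- by split => // k /= km; apply: Pp; exact: leq_trans mn.
- apply: contrapT => PN0; apply: noN; exists N => x y xy.
  apply: contrapT => no; apply: PN0; exists (x, y); split => //= n nN.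
  by split; rewrite /= leNgt; apply/negP => cn; apply: no; exists n => //;
    [left|right].
- have xy : x <> y.
    by move=> xy; have [/= + _] := Pxy 0%N; rewrite xy mdistxx; lra.
  have [n] := fgc _ _ xy; have [_ /(_ n (leqnn n))[/= + +]] := Pxy n; lra.
Qed.

(** * Growth of chains along forward orbits *)

Lemma iterK (f g : X -> X) n : cancel f g -> cancel (iter n f) (iter n g).
Proof. by move=> fK; elim: n => // n IHn x; rewrite iterSr /= fK IHn. Qed.

Lemma iterBK (f g : X -> X) m n x : cancel f g -> (m <= n)%N ->
  iter m g (iter n f x) = iter (n - m) f x.
Proof. by move=> fK mn; rewrite -{1}(subnKC mn) iterD iterK. Qed.

(** Closeness in the Bowen metric of order [n]; applying [f] [m] times lowers the order to
    [n - m]. *)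
Definition shadows (f : X -> X) (eta : R) n u v : Prop :=
  forall j, (j <= n)%N -> mdist (iter j f u) (iter j f v) <= eta.

(** Strong induction on [n]. Since the past of [D] is small, [D] exceeds [eps] at a first forward
    time [m <= N], and a piece selected from its image satisfies the same hypotheses for [n - m]. Up
    to time [m], distance from [s] keeps the orbit out of [U]. *)
Lemma linked_orbit_avoid (f g : X -> X) (s : seq X) (eps delta r eta : R)
    (N : nat) (U : set X) : cancel f g -> cancel g f ->
  selects s eps delta r eta ->
  (forall x y, delta <= mdist x y ->
    exists2 n, (n <= N)%N & eps < mdist (iter n f x) (iter n f y) \/
                            eps < mdist (iter n g x) (iter n g y)) ->
  (forall z, (forall y, y \in s -> r <= mdist y z) ->
    forall j, (j <= N)%N -> ~ U (iter j f z)) ->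
  forall n D, linked (shadows f eta n) D ->
    (exists a b, [/\ D a, D b & delta <= mdist a b]) ->
    (forall y z, y \in s -> D z -> r <= mdist y z) ->
    (forall u v, D u -> D v -> shadows g eps N u v) ->
  exists2 x, D x & forall j, (j <= n)%N -> ~ U (iter j f x).
Proof.
move=> fK gK sel unif avU n.
have [k] := ubnP n; elim: k n => // k IHk n nk D lD [a [b [Da Db ab]]] avD past.
have avDU x j : D x -> (j <= N)%N -> ~ U (iter j f x).
  by move=> Dx; apply: avU => y ys; exact: avD.
have [nN|Nn] := leqP n N.
  by exists a => // j jn; apply: avDU => //; exact: leq_trans nN.
pose wide m := `[< exists u v, [/\ D u, D v &
  eps < mdist (iter m f u) (iter m f v)] >].
have [m0 m0N m0wide] : exists2 m, (m <= N)%N & wide m.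
  have [m mN [fm|gm]] := unif _ _ ab.
    by exists m => //; apply/asboolP; exists a, b.
  by have := past _ _ Da Db m mN; rewrite leNgt gm.
have exw : exists m, wide m by exists m0.
case: (ex_minnP exw) => m /asboolP[u [v [Du Dv uv]]] minm.
have mN : (m <= N)%N by exact: leq_trans (minm _ m0wide) m0N.
have narrow j x y : (j < m)%N -> D x -> D y ->
    mdist (iter j f x) (iter j f y) <= eps.
  move=> jm Dx Dy; rewrite leNgt; apply/negP => xy.
  have := minm j; rewrite leqNgt jm => /(_ _)/negP; apply => //.
  by apply/asboolP; exists x, y.
(* The past includes time 0, so [D] itself is not wide and the order really drops. *)
have m0' : (0 < m)%N.
  case: m uv {minm mN narrow} => // uv.
  by have := past _ _ Du Dv 0%N (leq0n N); rewrite leNgt uv.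
have mn : (m <= n)%N by exact: leq_trans (ltnW Nn).
have symS l x y : shadows f eta l x y -> shadows f eta l y x.
  by move=> xy j jl; rewrite metric_sym; exact: xy.
have S0 l x y : shadows f eta l x y -> mdist x y <= eta.
  by move=> /(_ 0%N (leq0n l)).
have lfD : linked (shadows f eta (n - m)) (iter m f @` D).
  apply: linked_image lD => x y xy j jn.
  by rewrite -!iterD; apply: xy; rewrite addnC -leq_subRL.
have [D' [D'fD lD' ab' av' diam']] := sel _ _ _ _ (@symS _) (@S0 _) lfD
  (imageP _ Du) (imageP _ Dv) (ltW uv).
(* Three stretches: the selected diameter at time 0, minimality of [m] on the way back to [D], then
   the past of [D]. *)
have past' x y : D' x -> D' y -> shadows g eps N x y.
  move=> D'x D'y [_|j jN]; first exact: diam'.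
  have [x' Dx' <-] := D'fD _ D'x; have [y' Dy' <-] := D'fD _ D'y.
  have [jm|mj] := leqP j.+1 m.
    by rewrite !iterBK //; apply: narrow => //; rewrite -subn_gt0 subKn.
  rewrite -(subnK (ltnW mj)) !iterD !iterK //.
  by apply: past => //; apply: leq_trans jN; exact: leq_subr.
have nmk : (n - m < k)%N.
  rewrite -ltnS; apply: leq_trans nk.
  by rewrite ltnS ltn_subrL m0' (leq_ltn_trans _ Nn).
have [x' D'x' avx'] := IHk _ nmk D' lD' ab' av' past'.
have [x Dx xx'] := D'fD _ D'x'.
exists x => // j jn; have [jm|mj] := leqP j m.
  by apply: avDU => //; exact: leq_trans mN.
rewrite -(subnK (ltnW mj)) iterD xx'; apply: avx'; exact: leq_sub2r.
Qed.

(** * Periodicity, and the contradiction from unstable witnesses *)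

Lemma iter_mul_fixed (f : X -> X) n k x : iter n f x = x ->
  iter (k * n) f x = x.
Proof. by move=> fx; elim: k => // k IHk; rewrite mulSn iterD IHk. Qed.

(** Pigeonhole: two forward iterates coincide, and cancelling the earlier one with [g] closes the
    orbit. *)
Lemma finite_orbit_period (f g : X -> X) (A : set X) x : cancel f g ->
  finite_set A -> (forall n, A (iter n f x)) ->
  exists2 p, (0 < p)%N & iter p f x = x.
Proof.
move=> fK finA Ax; apply: contrapT => nop.
apply: infinite_nat; apply: (@sub_finite_set _ _ ((fun n => iter n f x) @^-1` A)).
  by move=> n _; exact: Ax.
apply: finite_preimage finA => m n _ _ /= mn.
wlog lt_mn : m n mn / (m < n)%N.
  move=> W; have [/W->//|/W->//|//] := ltngtP m n.
exfalso; apply: nop; exists (n - m)%N; first by rewrite subn_gt0.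
by rewrite -(iterBK _ fK (ltnW lt_mn)) -mn iterK.
Qed.

(* The finite-time substitute for a nontrivial continuum in the local unstable
   set of a point of [s]. *)
Definition unstable_witness (f g : X -> X) (s : seq X) (eps : R) n : Prop :=
  exists D y a b, [/\ connected D, y \in s /\ D y, D a /\ D b,
    eps < mdist a b &
    forall j, (0 < j <= n)%N -> forall u v, D u -> D v ->
      mdist (iter j g u) (iter j g v) <= eps].

Lemma unstable_contradiction (f g : X -> X) (eps : R) (s t : seq X) z0 :
  compact [set: X] -> continuous f -> continuous g -> cancel f g ->
  cancel g f -> 0 < eps -> expands f g eps ->
  (forall y, y \in s -> f y \in s /\ g y \in s) ->
  (forall j, iter j g z0 \in t) ->
  (forall y, y \in s -> eps < mdist y z0) ->
  (forall A : set X, closed A -> A <> [set: X] ->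
    (forall x, A x -> A (f x)) -> (forall x, A x -> A (g x)) ->
    finite_set A) ->
  (forall n, unstable_witness f g s eps n) -> False.
Proof.
move=> cX cf cg fK gK eps0 fgeps fgs gt sz0 fin wit.
have [delta [r [eta [d0 r0 e0 sel]]]] := linked_select (s ++ t) eps0.
have [N unif] := uniform_expands cX cf cg d0 fgeps.
(* The first condition keeps pasts that shadow [s] out of [U]; by the second, [iter j f z] in [U]
   with [j <= N] puts [z] within [r] of [iter j g z0], a point of [t]. *)
pose U := [set u | (forall y, y \in s -> eps < mdist y u) /\
  forall j, (j <= N)%N -> mdist (iter j g z0) (iter j g u) < r].
have Uz0 : U z0 by split => // j _; rewrite mdistxx.
have openU : open U.
  rewrite openE => u [su uz0]; apply: filterI.
    have : \forall v \near u, forall i : 'I_(size s),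
        eps < mdist (tnth (in_tuple s) i) v.
      apply: filter_forall => i; set y := tnth _ i.
      have ylt : 0 < mdist y u - eps by rewrite subr_gt0 su // mem_tnth.
      apply: filterS (near_mdist u ylt) => v uv.
      by have := metric_triangle y v u; rewrite (metric_sym v u); lra.
    apply: filterS => v sv y /(tnthP (in_tuple s))[i ->]; exact: sv.
  have : \forall v \near u, forall j : 'I_N.+1,
      mdist (iter j g z0) (iter j g v) < r.
    apply: filter_forall => j.
    have lt0 : 0 < r - mdist (iter j g z0) (iter j g u).
      by rewrite subr_gt0 uz0 // -ltnS.
    apply: filterS (near_iter_mdist j u cg lt0) => v /(_ j (leqnn j)) uv.
    by have := metric_triangle (iter j g z0) (iter j g u) (iter j g v); lra.
  apply: filterS => v sv j jN; exact: (sv (Ordinal (jN : (j < N.+1)%N))).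
have avU z : (forall y, y \in s ++ t -> r <= mdist y z) ->
    forall j, (j <= N)%N -> ~ U (iter j f z).
  move=> avz j jN [_ /(_ j jN)]; rewrite iterK // ltNge avz //.
  by rewrite mem_cat gt orbT.
have iters j y : y \in s -> iter j f y \in s /\ iter j g y \in s.
  move=> ys; elim: j => //= j [fs gs].
  by split; [case: (fgs _ fs)|case: (fgs _ gs)].
(* Approximations of order [n] to the limit pair. Time 0 is left out of the past condition because a
   witness is wider than [eps] there. *)
pose P n : set (X * X) := [set p | p.2 \in s] `&`
  (\bigcap_(y in [set` s]) [set p | r <= mdist y p.1]) `&`
  (\bigcap_(j in [set j | (0 < j <= n)%N])
     [set p | mdist (iter j g p.1) (iter j g p.2) <= eps]) `&`
  (\bigcap_(j in [set j | (j <= n)%N]) [set p | ~ U (iter j f p.1)]).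
have [|n|m n mn p [[[ps pr] pg] pU]|n|[x y] Pxy] := @compact_decreasing_closed _ P.
- by rewrite -setXTT; exact: compact_setX.
- apply: closedI; first apply: closedI; first apply: closedI.
  + apply: (@preimage_closed _ _ snd [set` s]).
      by move=> p _; exact: cvg_snd.
    have := @accessible_finite_set_closed X.
    move=> [/(_ (hausdorff_accessible (@metric_hausdorff _ X))) + _].
    by apply; exact: finite_seq.
  + apply: closed_bigI => y _.
    have cy : continuous (fun p : X * X => (y, p.1)).
      by move=> p; apply: cvg_pair; [exact: cvg_cst|exact: cvg_fst].
    exact: ((continuous_closedP _).1 cy _ (@closed_mdist_ge r)).
  + by apply: closed_bigI => j _; apply: closed_mdist_le; exact: iter_continuous.
  + apply: closed_bigI => j _.
    have cfj : continuous (fun p : X * X => iter j f p.1).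
      move=> p; apply: (@continuous_comp _ _ _ fst (iter j f)).
        exact: cvg_fst.
      exact: iter_continuous.
    exact: ((continuous_closedP _).1 cfj _ (open_closedC openU)).
- split; first split; first split => //.
  + by move=> j /= /andP[j0 jm]; apply: pg; rewrite /= j0 (leq_trans jm).
  + by move=> j /= jm; apply: pU; exact: leq_trans mn.
(* Selecting a piece for [linked_orbit_avoid] needs a past of length [N], hence [maxn n N]. *)
- have [D [y [a [b [cD [ys Dy] [Da Db] ab past]]]]] := wit (maxn n N).
  have symS x z : shadows f eta n x z -> shadows f eta n z x.
    by move=> xz j jn; rewrite metric_sym; exact: xz.
  have S0 x z : shadows f eta n x z -> mdist x z <= eta.
    by move=> /(_ 0%N (leq0n n)).
  have lD : linked (shadows f eta n) D.
    apply: connected_linked cD => // u.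
    by apply: filterS (near_iter_mdist n u cf e0) => v uv j jn; exact/ltW/uv.
  have [D' [D'D lD' ab' av' diam']] := sel _ _ _ _ symS S0 lD Da Db (ltW ab).
  have past' u v : D' u -> D' v -> shadows g eps N u v.
    move=> D'u D'v [_|j jN]; first exact: diam'.
    by apply: past; rewrite ?leq_max ?jN ?orbT //; exact: D'D.
  have [x D'x avx] := linked_orbit_avoid fK gK sel unif avU lD' ab' av' past'.
  exists (x, y); split; first split; first split => //.
  + by move=> w /= ws; apply: av' => //; rewrite mem_cat ws.
  + move=> j /= /andP[j0 jn]; apply: past => //; last exact: D'D.
    by rewrite j0 leq_max jn.
  + exact: avx.
have ys : y \in s by have [[[]]] := Pxy 0%N.
have far w : w \in s -> r <= mdist w x.
  by move=> ws; have [[[_ /(_ w ws)]]] := Pxy 0%N.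
have xy j : (0 < j)%N -> mdist (iter j g x) (iter j g y) <= eps.
  by move=> j0; have [[_ H] _] := Pxy j; apply: H; rewrite /= j0 leqnn.
have avx j : ~ U (iter j f x).
  by have [_ H] := Pxy j; apply: H; rewrite /=.
(* At positive times the past of [x] is [eps]-close to points of [s], while [U] lies farther than
   [eps] from [s]. *)
have avx' j : ~ U (iter j g x).
  case: j => [|j]; first exact: avx 0%N.
  move=> [/(_ _ (iters j.+1 y ys).2) + _].
  by rewrite metric_sym ltNge xy.
pose A := [set w | forall j, ~ U (iter j f w) /\ ~ U (iter j g w)].
have Af w : A w -> A (f w).
  move=> Aw j; split; first by rewrite -iterSr; exact: (Aw j.+1).1.
  case: j => [|j]; first exact: (Aw 1%N).1.
  by rewrite iterSr fK; exact: (Aw j).2.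
have Ag w : A w -> A (g w).
  move=> Aw j; split; last by rewrite -iterSr; exact: (Aw j.+1).2.
  case: j => [|j]; first exact: (Aw 1%N).2.
  by rewrite iterSr gK; exact: (Aw j).1.
(* [A] is closed, invariant and omits [z0], which lies in [U]. *)
have finA : finite_set A.
  apply: fin => //.
    suff -> : A = \bigcap_(j in [set: nat])
        ((iter j f @^-1` (~` U)) `&` (iter j g @^-1` (~` U))).
      by apply: closed_bigI => j _; apply: closedI;
        apply: ((continuous_closedP _).1 _ _ (open_closedC openU));
        exact: iter_continuous.
    by apply/seteqP; split=> [w Aw j _|w Aw j]; [exact: Aw|exact: (Aw j)].
  move=> AT; have : A z0 by rewrite AT.
  by move=> /(_ 0%N)[].
have [p p0 px] : exists2 p, (0 < p)%N & iter p g x = x.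
  by apply: finite_orbit_period gK finA _; elim=> [|n IHn] //=; exact: Ag.
have [p' p'0 py] : exists2 p, (0 < p)%N & iter p g y = y.
  by apply: finite_orbit_period gK (finite_seq s) _ => n; exact: (iters n y ys).2.
(* Time 0 is recovered at the positive common period [p' * p]. *)
have close j : mdist (iter j g x) (iter j g y) <= eps.
  case: j => [|j]; last exact: xy.
  have := xy (p' * p)%N; rewrite iter_mul_fixed // mulnC iter_mul_fixed //.
  by apply; rewrite muln_gt0 p0.
(* On periodic points forward iterates are also backward iterates, so control of the past
   suffices. *)
have back j w : iter (p' * p) g w = w ->
    iter j f w = iter (j * (p' * p) - j) g w.
  move=> /(iter_mul_fixed j) {1}<-; rewrite (iterBK _ gK) //.
  by rewrite leq_pmulr // muln_gt0 p'0.
have x_neq_y : x <> y.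
  by move=> xy'; have := far y ys; rewrite xy' mdistxx; lra.
have [n] := fgeps _ _ x_neq_y; rewrite !back.
- by have := close n; have := close (n * (p' * p) - n)%N; lra.
- by rewrite mulnC iter_mul_fixed.
- by rewrite iter_mul_fixed.
Qed.

(** * Unstable witnesses from local connectedness *)

Lemma unstable_witness_le (f g : X -> X) (s : seq X) (eps : R) m n :
  (m <= n)%N -> unstable_witness f g s eps n -> unstable_witness f g s eps m.
Proof.
move=> mn [D [y [a [b [cD sy Dab ab past]]]]]; exists D, y, a, b; split => //.
by move=> j /andP[j0 jm]; apply: past; rewrite j0 (leq_trans jm).
Qed.

(** The witness is the image of [W] at the first time [m] when it is wider than [eps]: up to [m]
    steps back it is narrow by minimality, and further back by smallness of [W]. *)
Lemma unstable_witness_stretch (f g : X -> X) (s : seq X) (eps : R) n k W q y :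
  continuous f -> cancel f g -> (forall j, iter j f q \in s) ->
  connected W -> W q -> W y -> eps < mdist (iter k f y) (iter k f q) ->
  (forall j, (j <= n)%N -> forall u v, W u -> W v ->
    mdist (iter j f u) (iter j f v) <= eps /\
    mdist (iter j g u) (iter j g v) <= eps) ->
  unstable_witness f g s eps n.
Proof.
move=> cf fK fs cW Wq Wy yq small.
pose wide m := `[< exists u v, [/\ W u, W v &
  eps < mdist (iter m f u) (iter m f v)] >].
have exw : exists m, wide m by exists k; apply/asboolP; exists y, q.
case: (ex_minnP exw) => m /asboolP[u [v [Wu Wv uv]]] minm.
have narrow j a b : (j < m)%N -> W a -> W b ->
    mdist (iter j f a) (iter j f b) <= eps.
  move=> jm Wa Wb; rewrite leNgt; apply/negP => ab.
  have := minm j; rewrite leqNgt jm => /(_ _)/negP; apply => //.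
  by apply/asboolP; exists a, b.
exists (iter m f @` W), (iter m f q), (iter m f u), (iter m f v); split => //.
- apply: connected_continuous_connected => //.
  exact/continuous_subspaceT/iter_continuous.
- move=> j /andP[j0 jn] _ _ [a Wa <-] [b Wb <-].
  have [jm|mj] := leqP j m.
    rewrite !iterBK //; apply: narrow => //.
    by rewrite ltn_subrL j0 (leq_trans j0).
  rewrite -(subnK (ltnW mj)) !iterD !iterK //.
  case: (small (j - m)%N _ a b Wa Wb) => //.
  by apply: leq_trans jn; exact: leq_subr.
Qed.

(** Each [n] gives a witness in one direction, and a witness of order [n] serves all smaller orders,
    so one direction works for every [n]. *)
Lemma unstable_or_stable (f g : X -> X) (s : seq X) (eps : R) q :
  locally_connected X -> continuous f -> continuous g -> cancel f g ->
  cancel g f -> 0 < eps -> expands f g eps ->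
  (forall j, iter j f q \in s /\ iter j g q \in s) ->
  (forall W, nbhs q W -> exists2 y, W y & y <> q) ->
  (forall n, unstable_witness f g s eps n) \/
  (forall n, unstable_witness g f s eps n).
Proof.
move=> lc cf cg fK gK eps0 fgeps qs limq.
have wit n : unstable_witness f g s eps n \/ unstable_witness g f s eps n.
  have eps2 : 0 < eps / 2 by lra.
  have [W [oW Wq cW Wsmall]] := lc q _ (filterI
    (near_iter_mdist n q cf eps2) (near_iter_mdist n q cg eps2)).
  have small j : (j <= n)%N -> forall u v, W u -> W v ->
      mdist (iter j f u) (iter j f v) <= eps /\
      mdist (iter j g u) (iter j g v) <= eps.
    move=> jn u v /Wsmall[/(_ j jn) fu /(_ j jn) gu].
    move=> /Wsmall[/(_ j jn) fv /(_ j jn) gv].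
    have := metric_triangle (iter j f u) (iter j f q) (iter j f v).
    have := metric_triangle (iter j g u) (iter j g q) (iter j g v).
    rewrite (metric_sym (iter j f u) (iter j f q)).
    by rewrite (metric_sym (iter j g u) (iter j g q)) => *; split; lra.
  have [y Wy yq] := limq W (open_nbhs_nbhs (conj oW Wq)).
  have [k [fk|gk]] := fgeps _ _ yq; [left|right].
    apply: (unstable_witness_stretch cf fK _ cW Wq Wy fk) => // j.
    by case: (qs j).
  apply: (unstable_witness_stretch cg gK _ cW Wq Wy gk).
    by move=> j; case: (qs j).
  move=> j jn u v Wu Wv; by have [? ?] := small j jn u v Wu Wv.
have [|nf] := pselect (forall n, unstable_witness f g s eps n); first by left.
right=> n; apply: contrapT => ng; apply: nf => m.
have [wf|wg] := wit (maxn m n).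
  exact: unstable_witness_le (leq_maxl _ _) wf.
by case: ng; exact: unstable_witness_le (leq_maxr _ _) wg.
Qed.

End Metric.

(** * Finite orbits and the CAM hypotheses *)

Lemma periodic_orbit_seq {X : eqType} (f g : X -> X) p q : cancel f g ->
  cancel g f -> (0 < p)%N -> iter p f q = q ->
  exists s : seq X, [/\ q \in s, forall y, y \in s -> f y \in s /\ g y \in s &
    forall y, y \in s -> iter p f y = y].
Proof.
case: p => // p fK gK _ pq.
exists [seq iter i f q | i <- iota 0 p.+1]; split.
- by apply/mapP; exists 0%N.
- move=> _ /mapP[i + ->]; rewrite mem_iota leq0n add0n ltnS => ip; split.
    have [->|ip'] := eqVneq i p.
      by apply/mapP; exists 0%N => //; rewrite -iterS.
    apply/mapP; exists i.+1 => //.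
    by rewrite mem_iota add0n ltnS ltn_neqAle ip'.
  case: i ip => [_|i ip].
    apply/mapP; exists p; first by rewrite mem_iota add0n ltnSn.
    by rewrite -[X in g X]pq iterS fK.
  rewrite iterS fK; apply/mapP; exists i => //.
  by rewrite mem_iota add0n ltnS; exact: ltnW.
- by move=> _ /mapP[i _ ->]; rewrite -iterD addnC iterD pq.
Qed.

Lemma seq_lower_bound {R : realDomainType} {T : eqType} (h : T -> R)
    (s : seq T) (c : R) : 0 < c -> (forall y, y \in s -> 0 < h y) ->
  exists e : R, [/\ 0 < e, e <= c & forall y, y \in s -> e <= h y].
Proof.
move=> c0; elim: s => [|a s IHs] hs; first by exists c.
have [|e [e0 ec es]] := IHs.
  by move=> y ys; apply: hs; rewrite inE ys orbT.
exists (Num.min e (h a)); split.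
- by rewrite lt_min e0 hs // mem_head.
- by rewrite ge_min ec.
- by move=> y; rewrite inE ge_min => /orP[/eqP ->|/es ->//]; rewrite lexx orbT.
Qed.

Theorem theorem2p11 (R : realType) (X : metricType R) :
  compact [set: X] -> locally_connected X ->
  ~ exists T Tinv : X -> X,
      [/\ homeomorphism T Tinv, expansive T Tinv & CAM T Tinv].
Proof.
move=> cX lc [f [g [[fK [gK [cf cg]]] [c [c0 fgc]] [[trans faith] dens fin]]]].
(* [Negz n] encodes [-(n+1)], hence the shifted exponent. *)
have fgc' : expands f g c.
  move=> x y /fgc[[n|n] xy]; first by exists n; left.
  by exists n.+1; right.
have period x : periodic_point f g x -> exists2 p, (0 < p)%N & iter p f x = x.
  move=> px; apply: (finite_orbit_period fK px) => n.
  by exists (Posz n).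
have orbit x : periodic_point f g x -> exists s : seq X,
    [/\ x \in s, forall y, y \in s -> f y \in s /\ g y \in s &
        exists z, z \notin s].
  move=> /period[p p0 px].
  have [s [xs fgs ps]] := periodic_orbit_seq fK gK p0 px.
  (* If [s] exhausted the space, [iter p f] would be the identity, against faithfulness. *)
  exists s; split => //; apply: contrapT => all_s.
  have : Posz p = 0 by apply: faith; apply/funext => z /=; apply: ps;
    apply: contrapT => zs; apply: all_s; exists z; exact/negP.
  by case => p_eq0; rewrite p_eq0 in p0.
(* On an empty space [f] itself would be the identity. *)
have [x0 _] : [set: X] !=set0.
  apply: contrapT => X0; have // : Posz 1 = 0.
  by apply: faith; apply/funext => z; case: X0; exists z.
have [q [_ perq]] := dens setT (ex_intro _ x0 I) openT.
have [s [qs fgs [z zs]]] := orbit q perq.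
have closed_s : closed [set` s].
  have [+ _] := @accessible_finite_set_closed X.
  move=> /(_ (hausdorff_accessible (@metric_hausdorff _ X))).
  by apply; exact: finite_seq.
have open_sC := closed_openC closed_s.
have [z0 [z0s perz0]] : (~` [set` s]) `&` periodic_point f g !=set0.
  by apply: dens open_sC; exists z => /=; exact/negP.
have [t [z0t fgt _]] := orbit z0 perz0.
have iters (u : seq X) x : (forall y, y \in u -> f y \in u /\ g y \in u) ->
    x \in u -> forall j, iter j f x \in u /\ iter j g x \in u.
  move=> fgu xu; elim=> //= j [fj gj].
  by split; [case: (fgu _ fj)|case: (fgu _ gj)].
(* [e] bounds from below both the expansive constant and the distances from [z0] to [s]; halving it
   makes [far] strict. *)
have [e [e0 ec es]] : exists e : R, [/\ 0 < e, e <= c &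
    forall y, y \in s -> e <= mdist y z0].
  apply: seq_lower_bound => // y ys; rewrite mdist_gt0.
  by apply/eqP => yz0; apply: z0s; rewrite /= -yz0.
have eps0 : 0 < e / 2 by lra.
have fgeps : expands f g (e / 2).
  by move=> x y /fgc'[n xy]; exists n; case: xy; [left|right]; lra.
have far y : y \in s -> e / 2 < mdist y z0 by move=> /es; lra.
(* If [q] were isolated, transitivity would carry it into the complement of the invariant set
   [s]. *)
have limq W : nbhs q W -> exists2 y, W y & y <> q.
  move=> Wq; apply: contrapT => noy.
  have Wsub : W `<=` [set q].
    by move=> y Wy; apply: contrapT => yq; apply: noy; exists y.
  have oq : open [set q].
    by rewrite openE => _ ->; exact: filterS Wq.
  have [||n [_ [[_ -> <-]]]] := trans _ _ oq open_sC; first by exists q.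
    by exists z0.
  by apply; case: n => n;
    [case: (iters s q fgs qs n)|case: (iters s q fgs qs n.+1)].
have fin' (A : set X) : closed A -> A <> [set: X] ->
    (forall x, A x -> A (f x)) -> (forall x, A x -> A (g x)) -> finite_set A.
  move=> clA AT fA gA; apply: fin => //; apply/seteqP; split.
    by move=> _ [x Ax <-]; exact: fA.
  by move=> x Ax; exists (g x); [exact: gA|exact: gK].
have [] := unstable_or_stable lc cf cg fK gK eps0 fgeps (iters s q fgs qs) limq.
  apply: (unstable_contradiction (t := t) cX cf cg fK gK eps0 fgeps fgs _ far fin').
  by move=> j; case: (iters t z0 fgt z0t j).
(* The other case is the same argument for the inverse system. *)
have gfeps : expands g f (e / 2).
  by move=> x y /fgeps[n []]; exists n; [right|left].
apply: (unstable_contradiction (t := t) cX cg cf gK fK eps0 gfeps _ _ far).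
- by move=> y /fgs[].
- by move=> j; case: (iters t z0 fgt z0t j).
- by move=> A clA AT gA fA; exact: fin'.
Qed.
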